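(* Let $N\ge1$, and let $\phi_0=R$ be a Yang--Baxter operator on $V$, $\phi_1,\dots,\phi_N\in\mathrm{Hom}(V^{\otimes2},V^{\otimes2})$, $\mu_0,\dots,\mu_N\in\mathrm{Hom}(V,V)$, $\alpha,\beta\in\mathbb k^\times$. Suppose that for all $n=1,\dots,N$ the quadruple $(\tilde R_{(n)},\alpha,\beta,\tilde\mu_{(n)})$, with $\tilde R_{(n)}=\sum_{i=0}^n\hbar^i\phi_i$ and $\tilde\mu_{(n)}=\sum_{i=0}^n\hbar^i\mu_i$, is an enhanced Yang--Baxter operator on $\tilde V_{(n)}=\mathbb k[[\hbar]]/(\hbar^{n+1})\otimes V$, with inverse $\tilde R_{(n)}^{-1}$ of $\tilde R_{(n)}$. Let an oriented knot or link $K$ be represented as the closure of an $m$-braid $b_m$, and let $\Psi(b_m)=\Psi_{(\tilde R_{(N)},\tilde R_{(N)}^{-1})}(b_m)=\sum_{i=0}^N\hbar^i\Psi^i(b_m)$ be the operator on $\tilde V_{(N)}^{\otimes m}$ defined from $\tilde R_{(N)}^{\pm1}$. Then $$\Phi_{(\tilde R_{(N)},\tilde R_{(N)}^{-1})}(b_m)=\sum_{k=0}^N\hbar^k\sum_{(i,j_1,\dots,j_m)\in\Gamma^{m+1}_k}\alpha^{-w(b_m)}\beta^{-m}\,\mathrm{Tr}\big(\Psi^i(b_m)(\mu_{j_1}\otimes\cdots\otimes\mu_{j_m})\big)\in\mathbb k[[\hbar]]/(\hbar^{N+1})$$ is invariant under Markov moves, and therefore defines a knot invariant $\Phi_{(\tilde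 R_{(N)},\tilde R_{(N)}^{-1})}(K)$. Writing $\Phi_{(\tilde R_{(N)},\tilde R_{(N)}^{-1})}(K)=\sum_{k=0}^N\hbar^k\Phi^k_{(\tilde R_{(N)},\tilde R_{(N)}^{-1})}(K)$, one has $$\Phi^k_{(\tilde R_{(N)},\tilde R_{(N)}^{-1})}(K)=\sum_{(i,j_1,\dots,j_m)\in\Gamma^{m+1}_k}\alpha^{-w(b_m)}\beta^{-m}\,\mathrm{Tr}\big(\Psi^i(b_m)(\mu_{j_1}\otimes\cdots\otimes\mu_{j_m})\big).$$
   Context: $\mathbb k$ is a commutative unital ring and $V$ a finitely generated free $\mathbb k$-module. A Yang--Baxter operator (YBO) on $V$ is an invertible linear map $R:V\otimes V\to V\otimes V$ with $(R\otimes\mathbb 1)(\mathbb 1\otimes R)(R\otimes\mathbb 1)=(\mathbb 1\otimes R)(R\otimes\mathbb 1)(\mathbb 1\otimes R)$. $\mathrm{Tr}_2$ denotes the partial trace over the second tensor factor. An enhanced YBO (EYBO) is a quadruple $(R,\alpha,\beta,\mu)$ with $R$ a YBO, $\alpha,\beta$ invertible scalars, $\mu:V\to V$ linear, such that $(\mu\otimes\mu)R=R(\mu\otimes\mu)$ and $\mathrm{Tr}_2(R^{\pm1}(\mu\otimes\mu))=\alpha^{\pm1}\beta\mu$. The same definitions are used over $\mathbb k[[\hbar]]/(\hbar^{n+1})$ for $\tilde V_{(n)}$, maps on $V$ being extended $\hbar$-linearly. $\Gamma^k_n=\{(j_1,\dots,j_k): j_1+\cdots+j_k=n,\ j_\ell\ge0\}$.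 $w(b)$ is the writhe of a braid (number of positive generators minus number of negative ones). $\Psi$ is the braid group representation $\sigma_i^{\pm1}\mapsto\mathbb 1^{\otimes(i-1)}\otimes\tilde R_{(N)}^{\pm1}\otimes\mathbb 1^{\otimes(m-i-1)}$. Markov moves are conjugation and (de)stabilization $b\leftrightarrow b\sigma_m^{\pm1}$. *)

(* Defs.v *)
From Stdlib Require Import PropExtensionality FunctionalExtensionality.
From HB Require Import structures.
From mathcomp Require Import all_boot all_order all_algebra.

Set Implicit Arguments.
Unset Strict Implicit.
Unset Printing Implicit Defensive.

Import GRing.Theory.
Local Open Scope ring_scope.

(* ------------------------------------------------------------------------ *)
(* The ring k[[h]]/(h^(n+1)), realized as k[h]/(h^(n+1)): elements are the   *)
(* polynomials of degree at most n, multiplied modulo h^(n+1).               *)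

Definition trunc (k : comUnitRingType) (n : nat) : Type :=
  {poly %/ ('X^(n.+1) : {poly k})}.

HB.instance Definition _ (k : comUnitRingType) (n : nat) :=
  GRing.ComAlgebra.copy (trunc k n) {poly %/ ('X^(n.+1) : {poly k})}.

Definition hbar {k : comUnitRingType} {n : nat} : trunc k n :=
  in_qpoly ('X^(n.+1)) 'X.

Definition hcoef {k : comUnitRingType} {n : nat} (i : nat) (p : trunc k n) : k :=
  (p : {poly k})`_i.

Section TruncUnit.
Variables (k : comUnitRingType) (n : nat).
Implicit Types p q : trunc k n.

Let hQ := mk_monic ('X^(n.+1) : {poly k}).

Let rmod_coef0 (a : {poly k}) : (Pdiv.CommonRing.rmodp a hQ)`_0 = a`_0.
Proof.
have := Pdiv.RingMonic.rdivp_eq (monicXn k n.+1) a.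
move=> /(congr1 (fun r : {poly k} => r`_0)).
by rewrite /hQ mk_monic_Xn coefD coefMXn /= add0r => ->.
Qed.

Let rmod_mulXn (a : {poly k}) : Pdiv.CommonRing.rmodp (a * 'X^(n.+1)) hQ = 0.
Proof. by rewrite /hQ mk_monic_Xn Pdiv.RingMonic.rmodp_mull ?monicXn. Qed.

Lemma hcoef0M p q : hcoef 0 (p * q) = hcoef 0 p * hcoef 0 q.
Proof. by rewrite /hcoef -coef0M; apply: rmod_coef0. Qed.

Lemma trunc_nilp p : hcoef 0 p = 0 -> p ^+ n.+1 = 0.
Proof.
rewrite /hcoef => p0; apply: val_inj => /=.
rewrite (poly_of_qpolyX (p : {poly %/ _})) -/hQ.
have pE : (p : {poly k}) = drop_poly 1 p * 'X.
  apply/polyP => i; rewrite coefMX coef_drop_poly.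
  by case: i => [|i] //=; rewrite addn1.
by rewrite [X in X ^+ _]pE exprMn rmod_mulXn.
Qed.

Definition trunc_unit : {pred trunc k n} := [pred p | hcoef 0 p \is a GRing.unit].

(* Geometric series: p = c (1 - (1 - c^-1 p)) with c the constant term.      *)
Definition trunc_inv p : trunc k n :=
  if p \in trunc_unit then
    (hcoef 0 p)^-1 *: \sum_(i < n.+1) (1 - (hcoef 0 p)^-1 *: p) ^+ i
  else p.

Lemma trunc_mulVr : {in trunc_unit, left_inverse 1 trunc_inv *%R}.
Proof.
move=> p up; rewrite /trunc_inv up; set c := hcoef 0 p; set u := 1 - _.
have pE : c^-1 *: p = 1 - u by rewrite opprB addrC subrK.
rewrite -scalerAl mulrC scalerAl pE.
have u0 : u ^+ n.+1 = 0.
  apply: trunc_nilp.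
  by rewrite /hcoef /= coefB coefZ coef1 -/(hcoef 0 p) -/c mulVr ?subrr.
by have := subrX1 u n.+1; rewrite u0 sub0r -opprB mulNr => /oppr_inj <-.
Qed.

Lemma trunc_unitPl p q : q * p = 1 -> p \in trunc_unit.
Proof.
move=> /(congr1 (hcoef 0)); rewrite hcoef0M => qp1; rewrite inE.
by apply/unitrPr; exists (hcoef 0 q); rewrite mulrC qp1 /hcoef coef1.
Qed.

Lemma trunc_inv_out : {in [predC trunc_unit], trunc_inv =1 id}.
Proof. by move=> p; rewrite inE /= /trunc_inv => /negPf ->. Qed.

HB.instance Definition _ := GRing.ComNzRing_hasMulInverse.Build (trunc k n)
  trunc_mulVr trunc_unitPl trunc_inv_out.

End TruncUnit.

(* ------------------------------------------------------------------------ *)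
(* Linear maps on tensor powers of V = S^d.  The tensors                     *)
(* e_{s_0} (x) .. (x) e_{s_{m-1}} with s : m.-tuple 'I_d form a basis of     *)
(* V^(x)m; maps act on columns, so the entry (s, t) is the coefficient of    *)
(* e_s in the image of e_t, and *m is composition.                           *)

Definition tensEnd (S : Type) (d m : nat) : Type := 'M[S]_#|{: m.-tuple 'I_d}|.

Section Tensors.
Variables (S : comUnitRingType) (d : nat).

Definition entry m (A : tensEnd S d m) (s t : m.-tuple 'I_d) : S :=
  A (enum_rank s) (enum_rank t).

Definition of_entries m (f : m.-tuple 'I_d -> m.-tuple 'I_d -> S) :
    tensEnd S d m :=
  \matrix_(i, j) f (enum_val i) (enum_val j).

(* A_0 (x) .. (x) A_{m-1}                                                    *)
Definition tensor m (A : 'I_m -> 'M[S]_d) : tensEnd S d m :=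
  of_entries (fun s t => \prod_(l < m) A l (tnth s l) (tnth t l)).

(* 1^(x)i (x) R (x) 1^(x)(n-1-i) on V^(x)(n+1), for i = 0, .., n-1: the      *)
(* factors i and i+1 are transformed by R and all others are left alone.     *)
Definition op_at n (R : tensEnd S d 2) (i : 'I_n) : tensEnd S d n.+1 :=
  let i0 := widen_ord (leqnSn n) i in
  let i1 := lift ord0 i in
  of_entries (fun s t =>
    entry R [tuple tnth s i0; tnth s i1] [tuple tnth t i0; tnth t i1]
      *+ [forall l, (l != i0) && (l != i1) ==> (tnth s l == tnth t l)]).

Definition ptrace2 (A : tensEnd S d 2) : 'M[S]_d :=
  \matrix_(a, b) \sum_(c < d) entry A [tuple a; c] [tuple b; c].

Record is_YBO (R : tensEnd S d 2) : Prop := IsYBO {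
  YBO_unit : R \in unitmx;
  YBO_braid :
    let R1 : tensEnd S d 3 := op_at R (ord0 : 'I_2) in
    let R2 : tensEnd S d 3 := op_at R (ord_max : 'I_2) in
    R1 *m R2 *m R1 = R2 *m R1 *m R2
}.

Record is_EYBO (R : tensEnd S d 2) (alpha beta : S) (mu : 'M[S]_d) : Prop :=
  IsEYBO {
    EYBO_YBO : is_YBO R;
    EYBO_alpha : alpha \is a GRing.unit;
    EYBO_beta : beta \is a GRing.unit;
    EYBO_comm : tensor (fun _ : 'I_2 => mu) *m R
                = R *m tensor (fun _ : 'I_2 => mu);
    EYBO_trace :
      ptrace2 (R *m tensor (fun _ : 'I_2 => mu)) = (alpha * beta) *: mu;
    EYBO_traceV :
      ptrace2 (invmx R *m tensor (fun _ : 'I_2 => mu))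
        = (alpha^-1 * beta) *: mu
  }.

End Tensors.

(* sum_(i <= n) h^i A_i, where the A_i are extended h-linearly.              *)
Definition hsum (k : comUnitRingType) (n p q : nat) (A : nat -> 'M[k]_(p, q)) :
    'M[trunc k n]_(p, q) :=
  \sum_(i < n.+1) hbar ^+ i *: map_mx (in_alg (trunc k n)) (A i).

(* ------------------------------------------------------------------------ *)
(* Braids on n+1 strands, as words in the generators: (i, true) stands for   *)
(* sigma_(i+1) and (i, false) for its inverse.  The braid group B_(n+1) is   *)
(* the quotient of the words by braid_eq (Artin's presentation).             *)

Definition braid (n : nat) := seq ('I_n * bool).

Definition braid_inv n (b : braid n) : braid n :=
  rev [seq (g.1, ~~ g.2) | g <- b].

Inductive braid_eq (n : nat) : braid n -> braid n -> Prop :=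
| be_refl b : braid_eq b b
| be_sym b c : braid_eq b c -> braid_eq c b
| be_trans b c d : braid_eq b c -> braid_eq c d -> braid_eq b d
| be_cat a b c d : braid_eq a b -> braid_eq c d -> braid_eq (a ++ c) (b ++ d)
| be_cancel i e : braid_eq [:: (i, e); (i, ~~ e)] [::]
| be_far (i j : 'I_n) : (i.+1 < j)%N ->
    braid_eq [:: (i, true); (j, true)] [:: (j, true); (i, true)]
| be_braid (i j : 'I_n) : i.+1 = j :> nat ->
    braid_eq [:: (i, true); (j, true); (i, true)]
             [:: (j, true); (i, true); (j, true)].

Definition writhe n (b : braid n) : int :=
  \sum_(g <- b) (if g.2 then 1 else -1).

(* b sigma^(+-1), where sigma is the generator involving the new strand.     *)
Definition stabilize n (b : braid n) (e : bool) : braid n.+1 :=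
  rcons [seq (widen_ord (leqnSn n) g.1, g.2) | g <- b] (ord_max, e).

Inductive markov_equiv : forall n n', braid n -> braid n' -> Prop :=
| me_braid n (b c : braid n) : braid_eq b c -> markov_equiv b c
| me_sym n n' (b : braid n) (c : braid n') :
    markov_equiv b c -> markov_equiv c b
| me_trans n n' n'' (b : braid n) (c : braid n') (d : braid n'') :
    markov_equiv b c -> markov_equiv c d -> markov_equiv b d
| me_conj n (a b : braid n) : markov_equiv b (a ++ b ++ braid_inv a)
| me_stab n (b : braid n) e : markov_equiv b (stabilize b e).

(* Oriented links up to isotopy, known only through the closure of braids    *)
(* and the theorems of Alexander (every link is the closure of a braid) and  *)
(* Markov; these determine the type up to a unique bijection compatible with *)
(* closures.                                                                 *)
Record link_theory := LinkTheory {
  link : Type;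
  braid_closure : forall n, braid n -> link;
  alexander : forall L : link, exists n (b : braid n), braid_closure b = L;
  markov : forall n n' (b : braid n) (c : braid n'),
    braid_closure b = braid_closure c <-> markov_equiv b c
}.

(* The conditions on a link_theory are consistent.                           *)
Definition markov_link_theory : link_theory.
Proof.
pose cls (x : {n & braid n}) (y : {n & braid n}) :=
  markov_equiv (tagged x) (tagged y).
pose T := {P : {n & braid n} -> Prop | exists x, P = cls x}.
pose cl n (b : braid n) : T := exist _ (cls (Tagged braid b)) (ex_intro _ _ erefl).
have cl_inj (A B : T) : sval A = sval B -> A = B.
  case: A B => [P hP] [Q hQ] /= PQ; rewrite PQ in hP *.
  by congr exist; apply: proof_irrelevance.
exists T cl.
- by case=> P [[n b] Pb]; exists n, b; apply: cl_inj.
- move=> n n' b c; split=> [/(congr1 sval) /= /(congr1 (@^~ (Tagged braid c))) | bc].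
    by rewrite /cls /= => ->; apply: me_braid; apply: be_refl.
  apply: cl_inj => /=; apply: functional_extensionality => x.
  apply: propositional_extensionality; split=> [bx|cx].
    exact: me_trans (me_sym bc) bx.
  exact: me_trans bc cx.
Defined.

(* ------------------------------------------------------------------------ *)

(* The braid group representation built from a pair (R, R').                 *)
Definition Psi (S : comUnitRingType) d (R R' : tensEnd S d 2) n (b : braid n) :
    tensEnd S d n.+1 :=
  \big[mulmx/1%:M]_(g <- b) op_at (if g.2 then R else R') g.1.

(* The tuples (j_1, .., j_m) of naturals of sum s; all entries are <= s.     *)
Definition Gamma (m s : nat) : {set m.-tuple 'I_s.+1} :=
  [set j : m.-tuple 'I_s.+1 | (\sum_(l < m) tnth j l == s)%N].

Section Invariant.
Variables (k : comUnitRingType) (d N : nat).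
Variables (R R' : tensEnd (trunc k N) d 2).
Variables (alpha beta : k) (mu : nat -> 'M[k]_d).

(* The coefficient of h^i in Psi(b).                                         *)
Definition Psi_coef n (b : braid n) (i : nat) : tensEnd k d n.+1 :=
  map_mx (hcoef i) (Psi R R' b).

Definition Phi_coef n (b : braid n) (s : nat) : k :=
  \sum_(j in Gamma n.+2 s)
    alpha ^ (- writhe b) * beta ^- n.+1 *
    \tr (Psi_coef b (tnth j ord0)
         *m tensor (fun l : 'I_n.+1 => mu (tnth j (lift ord0 l)))).

Definition Phi n (b : braid n) : trunc k N :=
  \sum_(s < N.+1) Phi_coef b s *: hbar ^+ s.

End Invariant.

(* Main.v *)
From Stdlib Require Import IndefiniteDescription.
Require Import Defs.
From mathcomp Require Import all_boot all_order all_algebra ring.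

Set Implicit Arguments.
Unset Strict Implicit.
Unset Printing Implicit Defensive.

Import GRing.Theory.
Local Open Scope ring_scope.

(** Truncating at order N does not change the argument that a single enhanced
    Yang--Baxter operator gives a link invariant: k[h]/(h^(N+1)) is a
    commutative ring like any other, and the hypothesis at n = N says that
    (R, alpha, beta, mu) := (sum h^i phi_i, alpha, beta, sum h^i mu_i) is an
    enhanced operator over that ring. So the proof has two independent halves.

    Over an arbitrary ring S, put
      [bracket b] = alpha^(-w(b)) beta^(-m) Tr(Psi(b) mu^(x)m).
    It depends only on the braid, because the Yang--Baxter equation, the
    invertibility of R and the commutation of maps on disjoint factors make Psi
    compatible with Artin's relations ([Psi_braid_eq]). It is invariant under
    conjugation because mu^(x)m commutes with Psi ([mu_PsiC]) and Tr is cyclic.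
    It is invariant under stabilization because the trace over the last of the
    m+1 factors only sees the final generator, which it turns into
    alpha^(+-1) beta mu ([ptrace_last_op_at]); this scalar is compensated by the
    change of writhe and of the number of strands.

    These facts all concern an operator on p tensor factors that is made to act
    on m factors through an injection f from positions to positions
    ([act_on f]). Composition of injections is composition of these actions;
    the actions are multiplicative and commute for disjoint images, because in
    a product the sum over the indices that agree with a given one off the
    image of f is a free sum over the indices of the p factors ([sum_pull]).

    The second half identifies the coefficients: the trace is a sum of products
    of m+1 elements of k[h]/(h^(N+1)), one entry of Psi(b) and m entries of mu,
    and for s <= N the coefficient of h^s in such a product is the convolution
    over the tuples of sum s ([hcoef_prod]). This shows that the bracket is
    exactly Phi ([PhiE]). *)

(** * Entries of operators on tensor powers *)

Section FactorActions.
Variables (S : comUnitRingType) (d : nat).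
Implicit Types (p m n : nat) (mu : 'M[S]_d).

Lemma entryE m (f : m.-tuple 'I_d -> m.-tuple 'I_d -> S) s t :
  entry (of_entries f) s t = f s t.
Proof. by rewrite /entry mxE !enum_rankK. Qed.

Lemma entryP m (A B : tensEnd S d m) :
  (forall s t, entry A s t = entry B s t) -> A = B.
Proof.
move=> AB; apply/matrixP => i j.
by have := AB (enum_val i) (enum_val j); rewrite /entry !enum_valK.
Qed.

Lemma entryM m (A B : tensEnd S d m) s t :
  entry (A *m B) s t = \sum_u entry A s u * entry B u t.
Proof.
rewrite /entry mxE.
by rewrite (reindex (@enum_rank _)) //=; apply/onW_bij/enum_rank_bij.
Qed.

Lemma entry1 m (s t : m.-tuple 'I_d) :
  entry (1%:M : tensEnd S d m) s t = (s == t)%:R.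
Proof. by rewrite /entry mxE (inj_eq enum_rank_inj). Qed.

Lemma tr_entry m (A : tensEnd S d m) : \tr A = \sum_s entry A s s.
Proof.
rewrite /mxtrace.
by rewrite (reindex (@enum_rank _)) //=; apply/onW_bij/enum_rank_bij.
Qed.

(** * Operators acting on some of the tensor factors *)

Definition pull p m (f : 'I_p -> 'I_m) (s : m.-tuple 'I_d) : p.-tuple 'I_d :=
  [tuple tnth s (f l) | l < p].

(** Where this fails, an operator that is the identity on the factors away from
    the image of f has entry 0 at (s, t). *)
Definition agree_off p m (f : 'I_p -> 'I_m) (s t : m.-tuple 'I_d) : bool :=
  [forall l, (l \notin codom f) ==> (tnth s l == tnth t l)].

(** The tensor product of A, on the factors f 0, .., f (p - 1) in this order,
    with the identity on all the others. *)
Definition act_on p m (f : 'I_p -> 'I_m) (A : tensEnd S d p) : tensEnd S d m :=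
  of_entries (fun s t => entry A (pull f s) (pull f t) *+ agree_off f s t).

Lemma agree_offP p m (f : 'I_p -> 'I_m) (s t : m.-tuple 'I_d) :
  reflect (forall l, l \notin codom f -> tnth s l = tnth t l) (agree_off f s t).
Proof.
apply: (iffP forallP) => st l; first by move/(implyP (st l))/eqP.
by apply/implyP => /st/eqP.
Qed.

Lemma agree_off_sym p m (f : 'I_p -> 'I_m) s t :
  agree_off f s t = agree_off f t s.
Proof. by apply: eq_forallb => l; rewrite eq_sym. Qed.

Lemma agree_off_trans p m (f : 'I_p -> 'I_m) s t u :
  agree_off f s t -> agree_off f s u = agree_off f t u.
Proof.
by move/agree_offP=> st; apply/agree_offP/agree_offP => H l /[dup] lf /H <-;
  rewrite st.
Qed.

Lemma agree_off_pull p m (f : 'I_p -> 'I_m) s t :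
  agree_off f s t && (pull f s == pull f t) = (s == t).
Proof.
apply/andP/eqP => [[/agree_offP st /eqP pst]|->].
  apply: eq_from_tnth => i; have [/codomP[l ->]|/st//] := boolP (i \in codom f).
  by have := congr1 (fun v => tnth v l) pst; rewrite !tnth_mktuple.
by split=> //; apply/agree_offP.
Qed.

Definition graft p m (f : 'I_p -> 'I_m) (s : m.-tuple 'I_d)
    (v : p.-tuple 'I_d) : m.-tuple 'I_d :=
  [tuple if [pick l | f l == i] is Some l then tnth v l else tnth s i | i < m].

Lemma agree_off_graft p m (f : 'I_p -> 'I_m) s v : agree_off f s (graft f s v).
Proof.
apply/agree_offP => l lf; rewrite tnth_mktuple; case: pickP => // i /eqP fi.
by rewrite -fi codom_f in lf.
Qed.

Lemma pull_graft p m (f : 'I_p -> 'I_m) s v :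
  injective f -> pull f (graft f s v) = v.
Proof.
move=> fI; apply: eq_from_tnth => l; rewrite !tnth_mktuple.
by case: pickP => [i /eqP/fI -> //|/(_ l)]; rewrite eqxx.
Qed.

(** Once the factors off the image of f are fixed, an index is determined by
    its p coordinates along f, and these are arbitrary because f is injective.
    The products of operators below are all computed through this bijection. *)
Lemma sum_pull p m (f : 'I_p -> 'I_m) s (F : p.-tuple 'I_d -> S) :
  injective f ->
  \sum_(u | agree_off f s u) F (pull f u) = \sum_v F v.
Proof.
move=> fI; rewrite (reindex_onto (graft f s) (pull f)) /=; last first.
  move=> u su; apply/eqP; rewrite -(agree_off_pull f) pull_graft // eqxx andbT.
  by rewrite -(agree_off_trans _ (agree_off_graft f s _)).
by apply: eq_big => [v|v _]; rewrite ?agree_off_graft pull_graft // ?eqxx.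
Qed.

(** The form in which [sum_pull] meets the sums over all indices produced by
    matrix products, where the agreement condition is a 0/1 coefficient. *)
Lemma sum_agree p m (f : 'I_p -> 'I_m) (g : m.-tuple 'I_d -> bool)
    (F : m.-tuple 'I_d -> S) (G : p.-tuple 'I_d -> S) s : injective f ->
  g =1 agree_off f s ->
  (forall u, g u -> F u = G (pull f u)) ->
  \sum_u F u *+ g u = \sum_v G v.
Proof.
move=> fI gE FG; rewrite -(sum_pull s G fI) [RHS]big_mkcond /=.
apply: eq_bigr => u _; rewrite -gE; case: ifP => // gu.
by rewrite FG // gu.
Qed.

Lemma act_onM p m (f : 'I_p -> 'I_m) (A B : tensEnd S d p) : injective f ->
  act_on f (A *m B) = act_on f A *m act_on f B.
Proof.
move=> fI; apply: entryP => s t; rewrite entryM !entryE entryM.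
under [RHS]eq_bigr do rewrite !entryE mulrnAl.
rewrite (sum_agree (s := s)
  (G := fun v => entry A (pull f s) v * entry B v (pull f t) *+ agree_off f s t)
  fI) // => [|u su]; first by rewrite -sumrMnl.
by rewrite -(agree_off_trans _ su) mulrnAr.
Qed.

Lemma act_on1 p m (f : 'I_p -> 'I_m) : act_on f 1%:M = 1%:M.
Proof.
apply: entryP => s t; rewrite entryE !entry1 -(agree_off_pull f).
by case: (agree_off f s t).
Qed.

Lemma eq_act_on p m (f g : 'I_p -> 'I_m) (A : tensEnd S d p) :
  f =1 g -> act_on f A = act_on g A.
Proof.
move=> fg; apply: entryP => s t; rewrite !entryE.
have pE u : pull f u = pull g u.
  by apply: eq_from_tnth => l; rewrite !tnth_mktuple fg.
rewrite !pE; congr (_ *+ nat_of_bool _); apply: eq_forallb => l.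
by rewrite (eq_codom fg).
Qed.

Lemma act_on_comp p m n (f : 'I_p -> 'I_m) (g : 'I_m -> 'I_n)
    (A : tensEnd S d p) : injective g ->
  act_on g (act_on f A) = act_on (g \o f) A.
Proof.
move=> gI; apply: entryP => s t; rewrite !entryE -mulrnA mulnb.
have pE u : pull f (pull g u) = pull (g \o f) u.
  by apply: eq_from_tnth => l; rewrite !tnth_mktuple.
rewrite !pE; congr (_ *+ nat_of_bool _).
apply/andP/agree_offP => [[/agree_offP stf /agree_offP stg] l lgf|H].
  have [/codomP[i li]|/stg//] := boolP (l \in codom g).
  have: i \notin codom f.
    by apply: contra lgf => /codomP[j ij]; apply/codomP; exists j; rewrite li ij.
  by move/stf; rewrite !tnth_mktuple -li.
split; apply/agree_offP => l lf; last first.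
  apply: H; apply: contra lf => /codomP[j ->]; exact: codom_f.
rewrite !tnth_mktuple; apply: H; apply: contra lf => /codomP[j /gI ->].
exact: codom_f.
Qed.

(** For disjoint images at most one intermediate index contributes, the one
    that takes its f-coordinates from t and its g-coordinates from s. The result
    is symmetric in (f, A) and (g, B), hence [act_on_disjointC]. *)
Lemma act_on_disjointE p q m (f : 'I_p -> 'I_m) (g : 'I_q -> 'I_m)
    (A : tensEnd S d p) (B : tensEnd S d q) s t :
  injective f -> (forall i j, f i != g j) ->
  entry (act_on f A *m act_on g B) s t =
    entry A (pull f s) (pull f t) * entry B (pull g s) (pull g t)
      *+ [forall l, (l \notin codom f) && (l \notin codom g)
                     ==> (tnth s l == tnth t l)].
Proof.
move=> fI fg; rewrite entryM; set b := [forall l, _].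
under eq_bigr do rewrite !entryE mulrnAl.
rewrite (sum_agree (s := s) (G := fun v => entry A (pull f s) v *
  (entry B (pull g s) (pull g t) *+ (b && (v == pull f t)))) fI) //; last first.
  move=> u /agree_offP su; congr (_ * _); congr (entry _ _ _ *+ nat_of_bool _).
    apply: eq_from_tnth => j; rewrite !tnth_mktuple su //.
    by apply/codomP => -[i] /eqP; rewrite eq_sym (negPf (fg _ _)).
  apply/agree_offP/andP => [ut|[/forallP st /eqP put] l lg].
    split; first apply/forallP => l.
      by apply/implyP => /andP[lf lg]; rewrite su // ut.
    apply/eqP; apply: eq_from_tnth => i; rewrite !tnth_mktuple ut //.
    by apply/codomP => -[j] /eqP; rewrite (negPf (fg _ _)).
  have [/codomP[i ->]|lf] := boolP (l \in codom f).
    by have := congr1 (fun v => tnth v i) put; rewrite !tnth_mktuple.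
  by have /implyP := st l; rewrite lf lg -su // => /(_ isT)/eqP.
rewrite (bigD1 (pull f t)) //= eqxx andbT big1 ?addr0 ?mulrnAr // => v /negPf ->.
by rewrite andbF mulr0.
Qed.

Lemma act_on_disjointC p q m (f : 'I_p -> 'I_m) (g : 'I_q -> 'I_m)
    (A : tensEnd S d p) (B : tensEnd S d q) :
  injective f -> injective g -> (forall i j, f i != g j) ->
  act_on f A *m act_on g B = act_on g B *m act_on f A.
Proof.
move=> fI gI fg; apply: entryP => s t; rewrite !act_on_disjointE //; last first.
  by move=> i j; rewrite eq_sym.
rewrite mulrC; congr (_ *+ nat_of_bool _); apply: eq_forallb => l.
by rewrite andbC.
Qed.

(** * Compatibility with the tensor powers of mu *)

Lemma prod_codom p m (f : 'I_p -> 'I_m) (F : 'I_m -> S) : injective f ->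
  \prod_l F l = \prod_(l | l \notin codom f) F l * \prod_l F (f l).
Proof.
move=> fI; rewrite (bigID (mem (codom f))) /= mulrC; congr (_ * _).
by rewrite -(big_uniq _ (introT (injectiveP f) fI)) big_image.
Qed.

Lemma entry_tensor m (M : 'I_m -> 'M[S]_d) s t :
  entry (tensor M) s t = \prod_l M l (tnth s l) (tnth t l).
Proof. exact: entryE. Qed.

Local Notation mu_pow mu m := (tensor (fun _ : 'I_m => mu)).

(** Away from f the operator [act_on f A] is the identity, so in a product with
    mu^(x)m the other factors contribute plain entries of mu, on whichever side
    mu^(x)m stands: commutation reduces to the p factors on which A acts. *)
Lemma entry_act_on_mu p m (f : 'I_p -> 'I_m) (A : tensEnd S d p) mu s t :
  injective f ->
  entry (act_on f A *m mu_pow mu m) s t =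
    \prod_(l | l \notin codom f) mu (tnth s l) (tnth t l)
      * entry (A *m mu_pow mu p) (pull f s) (pull f t).
Proof.
move=> fI; rewrite !entryM; under [LHS]eq_bigr do rewrite entryE mulrnAl.
rewrite mulr_sumr; apply: (sum_agree (s := s) fI) => // u /agree_offP su.
rewrite !entry_tensor (prod_codom _ fI) mulrCA; congr (_ * (_ * _)).
  by apply: eq_bigr => l lf; rewrite su.
by apply: eq_bigr => l _; rewrite !tnth_mktuple.
Qed.

Lemma entry_mu_act_on p m (f : 'I_p -> 'I_m) (A : tensEnd S d p) mu s t :
  injective f ->
  entry (mu_pow mu m *m act_on f A) s t =
    \prod_(l | l \notin codom f) mu (tnth s l) (tnth t l)
      * entry (mu_pow mu p *m A) (pull f s) (pull f t).
Proof.
move=> fI; rewrite !entryM.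
under [LHS]eq_bigr do rewrite [X in _ * X]entryE mulrnAr.
rewrite mulr_sumr; apply: (sum_agree (s := t) fI) => [u|u /agree_offP ut].
  by rewrite agree_off_sym.
rewrite !entry_tensor (prod_codom _ fI) -mulrA; congr (_ * (_ * _)).
  by apply: eq_bigr => l lf; rewrite ut.
by apply: eq_bigr => l _; rewrite !tnth_mktuple.
Qed.

Lemma act_on_muC p m (f : 'I_p -> 'I_m) (A : tensEnd S d p) mu :
  injective f -> mu_pow mu p *m A = A *m mu_pow mu p ->
  mu_pow mu m *m act_on f A = act_on f A *m mu_pow mu m.
Proof.
move=> fI muA; apply: entryP => s t.
by rewrite entry_act_on_mu // entry_mu_act_on // muA.
Qed.

(** * The partial trace over the last factor *)

Definition first_factors m : 'I_m -> 'I_m.+1 := widen_ord (leqnSn m).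

Lemma first_factors_inj m : injective (@first_factors m).
Proof. by move=> i j /(congr1 val) /= ij; apply: val_inj. Qed.

Definition snoc m (s : m.-tuple 'I_d) (c : 'I_d) : m.+1.-tuple 'I_d :=
  [tuple of rcons s c].

Lemma tnth_snoc_first m (s : m.-tuple 'I_d) c l :
  tnth (snoc s c) (first_factors l) = tnth s l.
Proof. by rewrite !(tnth_nth c) nth_rcons size_tuple /= ltn_ord. Qed.

Lemma tnth_snoc_last m (s : m.-tuple 'I_d) c : tnth (snoc s c) ord_max = c.
Proof. by rewrite !(tnth_nth c) nth_rcons size_tuple ltnn eqxx. Qed.

Lemma pull_snoc m (s : m.-tuple 'I_d) c :
  pull (@first_factors m) (snoc s c) = s.
Proof. by apply: eq_from_tnth => l; rewrite tnth_mktuple tnth_snoc_first. Qed.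

Lemma first_or_last m (l : 'I_m.+1) :
  l = ord_max \/ exists i, l = first_factors i.
Proof.
have [lm|] := ltnP l m; first by right; exists (Ordinal lm); apply: val_inj.
by move=> ml; left; apply: val_inj; apply/eqP; rewrite eqn_leq ml -ltnS ltn_ord.
Qed.

Lemma snoc_pull m (s : m.+1.-tuple 'I_d) :
  snoc (pull (@first_factors m) s) (tnth s ord_max) = s.
Proof.
apply: eq_from_tnth => l; case: (first_or_last l) => [->|[i ->]].
  by rewrite tnth_snoc_last.
by rewrite tnth_snoc_first tnth_mktuple.
Qed.

Lemma sum_snoc m (F : m.+1.-tuple 'I_d -> S) :
  \sum_s F s = \sum_s \sum_c F (snoc s c).
Proof.
rewrite pair_big (reindex (fun x => snoc x.1 x.2)) //=.
exists (fun s => (pull (@first_factors m) s, tnth s ord_max)) => [[s c]|s] _ /=.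
  by rewrite pull_snoc tnth_snoc_last.
by rewrite snoc_pull.
Qed.

Lemma agree_off_first m (s t : m.+1.-tuple 'I_d) :
  agree_off (@first_factors m) s t -> tnth s ord_max = tnth t ord_max.
Proof.
move/agree_offP; apply; apply/codomP => -[i /(congr1 val) /= /eqP].
by rewrite gtn_eqF ?ltn_ord.
Qed.

Definition ptrace_last m (X : tensEnd S d m.+1) : tensEnd S d m :=
  of_entries (fun s t => \sum_c entry X (snoc s c) (snoc t c)).

(** An operator that is the identity on the last factor can be taken out of
    the partial trace over that factor. *)
Lemma tr_act_on_first m (P : tensEnd S d m) (X : tensEnd S d m.+1) :
  \tr (act_on (@first_factors m) P *m X) = \tr (P *m ptrace_last X).
Proof.
rewrite !tr_entry sum_snoc; apply: eq_bigr => s _; rewrite entryM.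
under [RHS]eq_bigr do rewrite entryE mulr_sumr.
rewrite exchange_big; apply: eq_bigr => c _; rewrite entryM.
under [LHS]eq_bigr do rewrite entryE mulrnAl.
apply: (sum_agree (s := snoc s c) (@first_factors_inj m)) => // u su.
 rewrite pull_snoc; congr (_ * entry _ _ _).
by rewrite -{1}(snoc_pull u) -(agree_off_first su) tnth_snoc_last.
Qed.

(** * The generators of the braid representation *)

Definition adj n (i : 'I_n) (l : 'I_2) : 'I_n.+1 :=
  if l == ord0 then widen_ord (leqnSn n) i else lift ord0 i.

Lemma val_adj n (i : 'I_n) l : adj i l = (i + l)%N :> nat.
Proof.
by case: l => -[|[|//]] ? /=; rewrite /bump /= ?addn0 // addnC.
Qed.

Lemma adj_inj n (i : 'I_n) : injective (adj i).
Proof.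
by move=> l l' /(congr1 val); rewrite /= !val_adj => /addnI/val_inj.
Qed.

Lemma mem_codom_adj n (i : 'I_n) l :
  (l \in codom (adj i)) = (l == widen_ord (leqnSn n) i) || (l == lift ord0 i).
Proof.
apply/codomP/orP => [[j ->]|[]/eqP ->]; first by rewrite /adj; case: ifP; auto.
  by exists ord0.
by exists ord_max.
Qed.

Lemma pull_adj n (i : 'I_n) (s : n.+1.-tuple 'I_d) :
  pull (adj i) s
    = [tuple tnth s (widen_ord (leqnSn n) i); tnth s (lift ord0 i)].
Proof.
by apply: eq_from_tnth => -[[|[|//]] ?]; rewrite tnth_mktuple.
Qed.

Lemma op_atE n (R : tensEnd S d 2) (i : 'I_n) : op_at R i = act_on (adj i) R.
Proof.
apply: entryP => s t; rewrite !entryE !pull_adj; congr (_ *+ nat_of_bool _).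
by apply: eq_forallb => l; rewrite mem_codom_adj negb_or.
Qed.

Lemma op_at_first n (R : tensEnd S d 2) (i : 'I_n) :
  op_at R (widen_ord (leqnSn n) i) = act_on (@first_factors n.+1) (op_at R i).
Proof.
rewrite !op_atE act_on_comp; last exact: first_factors_inj.
by apply: eq_act_on => l; apply: val_inj; rewrite /= !val_adj.
Qed.

(** The two generators act on disjoint pairs of factors. *)
Lemma op_at_far n (R : tensEnd S d 2) (i j : 'I_n) : (i.+1 < j)%N ->
  op_at R i *m op_at R j = op_at R j *m op_at R i.
Proof.
move=> ij; rewrite !op_atE; apply: act_on_disjointC; try exact: adj_inj.
move=> l l'; rewrite -val_eqE /= !val_adj neq_ltn; apply/orP; left.
apply: leq_trans (leq_addr _ _); apply: leq_trans ij.
by rewrite ltnS -[i.+1]addn1 leq_add2l -ltnS.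
Qed.

(** The relation on V^(x)3 is transported by the injection of the three
    consecutive positions i, i+1, i+2. *)
Lemma op_at_braid n (R : tensEnd S d 2) (i j : 'I_n) : is_YBO R ->
  i.+1 = j :> nat ->
  op_at R i *m op_at R j *m op_at R i = op_at R j *m op_at R i *m op_at R j.
Proof.
move=> [_ /= braidR] ij; have jn : (i.+1 < n)%N by rewrite ij.
pose g (l : 'I_3) : 'I_n.+1 := inord (i + l).
have gE l : g l = (i + l)%N :> nat.
  rewrite inordK // ltnS; apply: leq_trans jn.
  by rewrite -[i.+2]addn2 leq_add2l -ltnS.
have gI : injective g.
  by move=> l l' /(congr1 val); rewrite /= !gE => /addnI/val_inj.
have -> : op_at R i = act_on g (op_at R (ord0 : 'I_2)).
  rewrite !op_atE act_on_comp //; apply: eq_act_on => l; apply: val_inj.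
  by rewrite /= val_adj gE val_adj.
have -> : op_at R j = act_on g (op_at R (ord_max : 'I_2)).
  rewrite !op_atE act_on_comp //; apply: eq_act_on => l; apply: val_inj.
  by rewrite /= val_adj gE val_adj addnA addn1 ij.
by rewrite -!act_onM // braidR.
Qed.

Lemma op_at_cancel n (A B : tensEnd S d 2) (i : 'I_n) :
  A *m B = 1%:M -> op_at A i *m op_at B i = 1%:M.
Proof.
by move=> AB; rewrite !op_atE -act_onM ?AB ?act_on1 //; apply: adj_inj.
Qed.

(** The trace condition of an enhanced operator on V^(x)2, spread over n+2
    factors: the first n factors carry mu before and after, and the partial
    trace turns the last two into a multiple of mu on the (n+1)-st. *)
Lemma ptrace_last_op_at n (Q : tensEnd S d 2) mu x :
  ptrace2 (Q *m mu_pow mu 2) = x *: mu ->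
  ptrace_last (op_at Q (ord_max : 'I_n.+1) *m mu_pow mu n.+2)
    = x *: mu_pow mu n.+1.
Proof.
move=> QE; apply: entryP => s t; rewrite entryE.
have adj_max c (u : n.+1.-tuple 'I_d) :
    pull (adj ord_max) (snoc u c) = [tuple tnth u ord_max; c].
  rewrite pull_adj; congr [tuple _; _]; first exact: tnth_snoc_first.
  by rewrite -[RHS](tnth_snoc_last u); congr tnth; apply: val_inj.
(* Off the last two positions the factors of the product are the entries of mu
   at (s, t), so the sum over c only concerns the remaining entry of Q. *)
under eq_bigr => c _.
  rewrite op_atE entry_act_on_mu; last exact: adj_inj.
  rewrite !adj_max big_mkcond !big_ord_recr /= !mem_codom_adj.
  rewrite (_ : ord_max == lift ord0 _); last by rewrite -val_eqE /= /bump.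
  rewrite (_ : widen_ord _ ord_max == widen_ord _ ord_max) // orbT /= !mulr1.
  under eq_bigr => l _.
    rewrite mem_codom_adj -!val_eqE /= /bump /= add1n.
    rewrite !ltn_eqF ?ltn_ord //=; last exact/ltnW/ltn_ord.
    rewrite -[widen_ord (leqnSn n.+1) _]/(first_factors _) !tnth_snoc_first.
  over.
over.
rewrite -mulr_sumr.
have /matrixP/(_ (tnth s ord_max) (tnth t ord_max)) := QE; rewrite !mxE => ->.
by rewrite [entry _ _ _]mxE -/(entry _ _ _) entry_tensor big_ord_recr /= mulrCA.
Qed.

End FactorActions.

(** * Writhe *)

Lemma writhe_cat n (a b : braid n) : writhe (a ++ b) = writhe a + writhe b.
Proof. by rewrite /writhe big_cat. Qed.

Lemma writhe_inv n (b : braid n) : writhe (braid_inv b) = - writhe b.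
Proof.
rewrite /writhe /braid_inv (perm_big _ (permEl (perm_rev _))) big_map -sumrN.
by apply: eq_bigr => -[i []] _ //=; rewrite opprK.
Qed.

Lemma writhe_braid_eq n (b c : braid n) : braid_eq b c -> writhe b = writhe c.
Proof.
elim=> {b c} //.
- by move=> b c d0 _ -> _ ->.
- by move=> a b c d0 _ ab _ cd; rewrite !writhe_cat ab cd.
- by move=> i [] ; rewrite /writhe !big_cons big_nil.
- by move=> i j _; rewrite /writhe !big_cons.
- by move=> i j _; rewrite /writhe !big_cons.
Qed.

Lemma writhe_stabilize n (b : braid n) e :
  writhe (stabilize b e) = writhe b + (if e then 1 else -1).
Proof. by rewrite /stabilize -cats1 writhe_cat /writhe big_map big_seq1. Qed.

(** * Markov invariance for an enhanced operator over a ring *)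

Section MarkovInvariance.
Variables (S : comUnitRingType) (d : nat).
Variables (R : tensEnd S d 2) (alpha beta : S) (mu : 'M[S]_d).
Hypothesis eyboR : is_EYBO R alpha beta mu.

Let R_unit : R \in unitmx := YBO_unit (EYBO_YBO eyboR).
Let sgnR (e : bool) : tensEnd S d 2 := if e then R else invmx R.
Local Notation mu_pow m := (tensor (fun _ : 'I_m => mu)).
Local Notation psi b := (Psi R (invmx R) b).

Lemma Psi_cat n (a b : braid n) : psi (a ++ b) = psi a *m psi b.
Proof.
elim: a => [|g a IHa]; first by rewrite {2}/Psi big_nil mul1mx.
by rewrite /= /Psi !big_cons -!/(Psi _ _ _) IHa mulmxA.
Qed.

Lemma Psi_gen n (g : 'I_n * bool) : psi [:: g] = op_at (sgnR g.2) g.1.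
Proof. by rewrite /Psi big_cons big_nil mulmx1. Qed.

Lemma sgnR_cancel e : sgnR e *m sgnR (~~ e) = 1%:M.
Proof. by case: e; rewrite /= (mulmxV, mulVmx). Qed.

Lemma Psi_braid_eq n (b c : braid n) : braid_eq b c -> psi b = psi c.
Proof.
elim=> {b c} //.
- by move=> b c d0 _ -> _ ->.
- by move=> a b c d0 _ ab _ cd; rewrite !Psi_cat ab cd.
- move=> i e; rewrite /Psi !big_cons big_nil mulmx1.
  by apply: op_at_cancel; apply: sgnR_cancel.
- by move=> i j ij; rewrite /Psi !big_cons big_nil /= !mulmx1 op_at_far.
- move=> i j ij; rewrite /Psi !big_cons big_nil /= !mulmx1 !mulmxA.
  by rewrite op_at_braid //; apply: EYBO_YBO eyboR.
Qed.

Lemma Psi_inv n (a : braid n) : psi (braid_inv a) *m psi a = 1%:M.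
Proof.
elim: a => [|[i e] a IHa]; first by rewrite /Psi !big_nil mulmx1.
rewrite -cat1s /braid_inv map_cat rev_cat !Psi_cat -mulmxA.
rewrite (mulmxA (psi _) (psi [:: _])).
rewrite !Psi_gen op_at_cancel ?mul1mx //=.
by rewrite -{2}(negbK e); apply: sgnR_cancel.
Qed.

(** Commutation with R implies commutation with its inverse, so both kinds of
    generators commute with mu (x) mu. *)
Lemma mu_sgnRC e : mu_pow 2 *m sgnR e = sgnR e *m mu_pow 2.
Proof.
have muR := EYBO_comm eyboR; case: e => //=.
by rewrite -[LHS](mulKmx R_unit) (mulmxA R) -muR -!mulmxA mulmxV // mulmx1.
Qed.

Lemma mu_PsiC n (b : braid n) : mu_pow n.+1 *m psi b = psi b *m mu_pow n.+1.
Proof.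
elim: b => [|[i e] b IHb]; first by rewrite /Psi big_nil mulmx1 mul1mx.
rewrite /Psi big_cons -/(psi b) mulmxA op_atE act_on_muC ?mu_sgnRC //.
  by rewrite -!mulmxA IHb.
exact: adj_inj.
Qed.

(** The Turaev invariant of the enhanced operator (R, alpha, beta, mu). *)
Definition bracket n (b : braid n) : S :=
  alpha ^ (- writhe b) * beta ^- n.+1 * \tr (psi b *m mu_pow n.+1).

Lemma tr_Psi_conj n (a b : braid n) :
  \tr (psi (a ++ b ++ braid_inv a) *m mu_pow n.+1) = \tr (psi b *m mu_pow n.+1).
Proof.
rewrite !Psi_cat -!mulmxA mxtrace_mulC -!mulmxA mu_PsiC.
by rewrite (mulmxA (psi (braid_inv a))) Psi_inv mul1mx.
Qed.

Lemma Psi_stabilize n (b : braid n) e :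
  psi (stabilize b e)
    = act_on (@first_factors n.+1) (psi b)
      *m op_at (sgnR e) (ord_max : 'I_n.+1).
Proof.
rewrite /stabilize -cats1 Psi_cat Psi_gen; congr (_ *m _).
elim: b => [|[i e'] b IHb]; first by rewrite /Psi !big_nil act_on1.
rewrite /= /Psi !big_cons -!/(Psi _ _ _) IHb op_at_first -act_onM //.
exact: first_factors_inj.
Qed.

(** The old braid does not touch the new strand, so the partial trace over it
    reaches the new generator and the trace condition for R or its inverse
    applies. *)
Lemma tr_Psi_stabilize n (b : braid n) e :
  \tr (psi (stabilize b e) *m mu_pow n.+2)
    = alpha ^ (if e then 1 else -1) * beta * \tr (psi b *m mu_pow n.+1).
Proof.
rewrite Psi_stabilize -mulmxA tr_act_on_first.
have trR : ptrace2 (sgnR e *m mu_pow 2)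
    = (alpha ^ (if e then 1 else -1) * beta) *: mu.
  by case: e; [apply: EYBO_trace eyboR | apply: EYBO_traceV eyboR].
by rewrite (ptrace_last_op_at n trR) -scalemxAr mxtraceZ.
Qed.

Lemma bracket_stabilize n (b : braid n) e : bracket (stabilize b e) = bracket b.
Proof.
have alphaU := EYBO_alpha eyboR; have betaU := EYBO_beta eyboR.
rewrite /bracket tr_Psi_stabilize writhe_stabilize opprD exprzDr //.
set z : int := if e then 1 else -1; set T := \tr _.
have zK : alpha ^ (- z) * alpha ^ z = 1 by rewrite -exprzDr // addNr expr0z.
have bK : beta ^- n.+2 * beta = beta ^- n.+1.
  by rewrite exprSr invrM ?unitrX // mulrAC mulVr ?mul1r.
rewrite -bK -[alpha ^ (- writhe b) in RHS]mulr1 -zK; ring.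
Qed.

Lemma bracket_markov n n' (b : braid n) (c : braid n') :
  markov_equiv b c -> bracket b = bracket c.
Proof.
elim=> {n n' b c} [n b c bc|//|n n' n'' b c e _ -> _ -> //|n a b|n b e].
- by rewrite /bracket (Psi_braid_eq bc) (writhe_braid_eq bc).
- by rewrite /bracket tr_Psi_conj !writhe_cat writhe_inv addrC subrK.
- by rewrite bracket_stabilize.
Qed.

End MarkovInvariance.

(** * Coefficients in k[h]/(h^(N+1)) *)

Section Coefficients.
Variables (k : comUnitRingType).
Implicit Types (N s : nat).

Definition of_poly N : {poly k} -> trunc k N := in_qpoly 'X^(N.+1).

Lemma hcoef_of_poly N s (a : {poly k}) : (s <= N)%N ->
  hcoef s (of_poly N a) = a`_s.
Proof.
move=> sN; have := Pdiv.RingMonic.rdivp_eq (monicXn k N.+1) a.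
move=> /(congr1 (fun r : {poly k} => r`_s)).
by rewrite /hcoef /= mk_monic_Xn coefD coefMXn ltnS sN add0r => ->.
Qed.

Lemma trunc_eqP N (p q : trunc k N) :
  (forall s, (s <= N)%N -> hcoef s p = hcoef s q) -> p = q.
Proof.
move=> pq; apply: val_inj; apply/polyP => i.
have [/pq //|Ni] := leqP i N.
have sizeN (r : trunc k N) : (size (r : {poly k}) <= i)%N.
  apply: leq_trans Ni; apply: leq_trans (size_npoly r) _.
  by rewrite mk_monic_Xn size_polyXn.
by rewrite [LHS](nth_default 0 (sizeN p)) [RHS](nth_default 0 (sizeN q)).
Qed.

Lemma of_polyK N (p : trunc k N) : of_poly N (p : {poly k}) = p.
Proof. by apply: trunc_eqP => s sN; rewrite hcoef_of_poly. Qed.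

Lemma hcoef_sum N s I (r : seq I) (P : pred I) (F : I -> trunc k N) :
  hcoef s (\sum_(i <- r | P i) F i) = \sum_(i <- r | P i) hcoef s (F i).
Proof.
by rewrite /hcoef (raddf_sum (val : trunc k N -> {poly k})) coef_sum.
Qed.

Lemma hcoefZ N s a (p : trunc k N) : hcoef s (a *: p) = a * hcoef s p.
Proof. by rewrite /hcoef coefZ. Qed.

Lemma of_poly_prod N (I : finType) (P : I -> {poly k}) :
  of_poly N (\prod_i P i) = \prod_i of_poly N (P i).
Proof. by rewrite /of_poly rmorph_prod. Qed.

(** The index set allows entries up to s only, so the factors are first cut off
    after degree s; this is invisible modulo h^(s+1), and after it the product
    of sums expands over tuples. *)
Lemma coef_prod_Gamma m s (P : 'I_m -> {poly k}) :
  (\prod_l P l)`_s = \sum_(j in Gamma m s) \prod_l (P l)`_(tnth j l).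
Proof.
pose Q l : {poly k} := \sum_(i < s.+1) (P l)`_i *: 'X^i.
have -> : (\prod_l P l)`_s = (\prod_l Q l)`_s.
  rewrite -!(hcoef_of_poly _ (leqnn s)) !of_poly_prod; congr hcoef.
  apply: eq_bigr => l _; apply: trunc_eqP => i si.
  rewrite !hcoef_of_poly // coef_sum (bigD1 (Ordinal (si : (i < s.+1)%N))) //=.
  rewrite coefZ coefXn eqxx mulr1 big1 ?addr0 // => j /eqP ji.
  rewrite coefZ coefXn; case: eqP => [ij|]; rewrite ?mulr0 //.
  by case: ji; apply: val_inj.
rewrite bigA_distr_bigA /= coef_sum [RHS]big_mkcond /=.
rewrite (reindex (fun j : m.-tuple 'I_s.+1 => [ffun l => tnth j l])) /=;
  last first.
  exists (fun f : {ffun 'I_m -> 'I_s.+1} => [tuple f l | l < m]) => x _ /=.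
    by apply: eq_from_tnth => l; rewrite tnth_mktuple ffunE.
  by apply/ffunP => l; rewrite ffunE tnth_mktuple.
apply: eq_bigr => j _; under eq_bigr do rewrite ffunE.
rewrite scaler_prod -expr_sum coefZ coefXn inE eq_sym.
by case: eqP => _; rewrite ?mulr1 ?mulr0.
Qed.

Lemma hcoef_prod N s m (p : 'I_m -> trunc k N) : (s <= N)%N ->
  hcoef s (\prod_l p l) = \sum_(j in Gamma m s) \prod_l hcoef (tnth j l) (p l).
Proof.
move=> sN; rewrite -coef_prod_Gamma -(hcoef_of_poly _ sN) of_poly_prod.
by congr hcoef; apply: eq_bigr => l _; rewrite of_polyK.
Qed.

Lemma hbarXE N i : hbar ^+ i = of_poly N 'X^i.
Proof. by rewrite /of_poly rmorphXn. Qed.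

Lemma hcoef_hbarX N s i : (s <= N)%N ->
  hcoef s (hbar ^+ i : trunc k N) = (s == i)%:R.
Proof. by move=> sN; rewrite hbarXE hcoef_of_poly // coefXn. Qed.

Lemma hcoef_hexpansion N s (c : nat -> k) : (s <= N)%N ->
  hcoef s (\sum_(i < N.+1) c i *: hbar ^+ i : trunc k N) = c s.
Proof.
move=> sN; rewrite hcoef_sum (bigD1 (Ordinal (sN : (s < N.+1)%N))) //=.
rewrite hcoefZ hcoef_hbarX // eqxx mulr1 big1 ?addr0 // => i /eqP is_.
rewrite hcoefZ hcoef_hbarX //; case: eqP => [si|_]; last by rewrite mulr0.
by case: is_; apply: val_inj.
Qed.

Lemma hcoef_hsum N s p q (A : nat -> 'M[k]_(p, q)) i j : (s <= N)%N ->
  hcoef s (hsum N A i j) = A s i j.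
Proof.
move=> sN; rewrite -[RHS](hcoef_hexpansion (fun s => A s i j) sN).
congr hcoef; rewrite /hsum summxE; apply: eq_bigr => l _.
by rewrite !mxE /= -scalerAr mulr1.
Qed.

Variables (d N : nat) (R R' : tensEnd (trunc k N) d 2).
Variables (alpha beta : k) (mu : nat -> 'M[k]_d).

(** Each term of the trace is a product of n+1 elements of k[h]/(h^(N+1)): an
    entry of A, placed at index 0, and one entry of mu for each factor. The
    convolution formula for such products is the sum over Gamma. *)
Lemma hcoef_tr_tensor n s (A : tensEnd (trunc k N) d n) : (s <= N)%N ->
  hcoef s (\tr (A *m tensor (fun _ : 'I_n => hsum N mu))) =
  \sum_(j in Gamma n.+1 s)
    \tr ((map_mx (hcoef (tnth j ord0)) A : tensEnd k d n)
      *m tensor (fun l : 'I_n => mu (tnth j (lift ord0 l)))).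
Proof.
move=> sN; rewrite tr_entry hcoef_sum.
under [RHS]eq_bigr do rewrite tr_entry.
rewrite exchange_big; apply: eq_bigr => u _ /=.
rewrite entryM hcoef_sum; under [RHS]eq_bigr do rewrite entryM.
rewrite exchange_big; apply: eq_bigr => v _ /=.
pose F l := if unlift ord0 l is Some l' then hsum N mu (tnth v l') (tnth u l')
            else entry A u v.
have -> : entry A u v * entry (tensor (fun=> hsum N mu)) v u
    = \prod_(l < n.+1) F l.
  rewrite entry_tensor big_ord_recl /F unlift_none; congr (_ * _).
  by apply: eq_bigr => l _; rewrite liftK.
rewrite hcoef_prod //; apply: eq_bigr => j _.
rewrite big_ord_recl /F unlift_none entry_tensor /entry mxE; congr (_ * _).
apply: eq_bigr => l _; rewrite liftK hcoef_hsum //.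
by apply: leq_trans sN; rewrite -ltnS.
Qed.

Lemma Phi_coefE n (b : braid n) s : (s <= N)%N ->
  Phi_coef R R' alpha beta mu b s =
  alpha ^ (- writhe b) * beta ^- n.+1 *
    hcoef s (\tr (Psi R R' b *m tensor (fun _ : 'I_n.+1 => hsum N mu))).
Proof. by move=> sN; rewrite hcoef_tr_tensor // mulr_sumr. Qed.

Lemma hcoef_Phi n (b : braid n) s : (s <= N)%N ->
  hcoef s (Phi R R' alpha beta mu b) = Phi_coef R R' alpha beta mu b s.
Proof. exact: hcoef_hexpansion. Qed.

End Coefficients.

(** Both sides live over k[h]/(h^(N+1)), so it suffices to compare the
    coefficients up to h^N; the normalizing factor is a scalar of k, hence comes
    out of each of them. *)
Lemma PhiE (k : comUnitRingType) (d N : nat) (R : tensEnd (trunc k N) d 2)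
    (alpha beta : k) (mu : nat -> 'M[k]_d) n (b : braid n) :
  alpha \is a GRing.unit -> beta \is a GRing.unit ->
  Phi R (invmx R) alpha beta mu b = bracket R alpha%:A beta%:A (hsum N mu) b.
Proof.
move=> alU beU.
rewrite /bracket -(rmorphXz (in_alg (trunc k N))) //.
rewrite -(rmorphXn (in_alg (trunc k N))).
rewrite -(rmorphV (in_alg (trunc k N))) ?unitrX //.
rewrite -(rmorphM (in_alg (trunc k N))) /= mulr_algl.
by apply: trunc_eqP => s sN; rewrite hcoef_Phi // Phi_coefE // hcoefZ.
Qed.

(** * The invariant of links *)

Theorem theorem8p3 (k : comUnitRingType) (d N : nat) (hN : (1 <= N)%N)
  (phi : nat -> tensEnd k d 2) (mu : nat -> 'M[k]_d) (alpha beta : k)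
  (halpha : alpha \is a GRing.unit) (hbeta : beta \is a GRing.unit)
  (hphi0 : is_YBO (phi 0%N))
  (hEYBO : forall n : nat, (1 <= n <= N)%N ->
    is_EYBO (hsum n phi : tensEnd (trunc k n) d 2)
      (alpha%:A) (beta%:A) (hsum n mu)) :
  let R : tensEnd (trunc k N) d 2 := hsum N phi in
  (forall (n n' : nat) (b : braid n) (c : braid n'), markov_equiv b c ->
     Phi R (invmx R) alpha beta mu b = Phi R (invmx R) alpha beta mu c)
  /\
  (forall T : link_theory,
     exists F : link T -> trunc k N,
       forall (L : link T) (n : nat) (b : braid n), @braid_closure T n b = L ->
         F L = Phi R (invmx R) alpha beta mu b
         /\ (forall s : nat, (s <= N)%N ->
               hcoef s (F L) = Phi_coef R (invmx R) alpha beta mu b s)).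
Proof.
move=> R.
have inv n n' (b : braid n) (c : braid n') : markov_equiv b c ->
    Phi R (invmx R) alpha beta mu b = Phi R (invmx R) alpha beta mu c.
  move=> bc; rewrite !PhiE //; apply: bracket_markov bc.
  by apply: hEYBO; rewrite hN leqnn.
split=> // T.
(* By definition of a link theory, the closures of the two braids are equal only
   if the braids are Markov equivalent, so the choice of a representative braid
   does not matter. *)
have value (L : link T) : {x | exists n (b : braid n),
    braid_closure T b = L /\ x = Phi R (invmx R) alpha beta mu b}.
  apply: constructive_indefinite_description.
  have [n [b bL]] := alexander L.
  by exists (Phi R (invmx R) alpha beta mu b), n, b.
exists (fun L => sval (value L)) => L n b bL.
have FL : sval (value L) = Phi R (invmx R) alpha beta mu b.
  case: (value L) => x /= [n' [c [cL ->]]]; apply: inv.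
  by apply/(@markov T); rewrite cL bL.
by split=> // s sN; rewrite FL hcoef_Phi.
Qed.
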